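(* Let $\{(X_t,c_t):t\in T\}$ be a family of pairwise disjoint fuzzy closure spaces and let $(X,c)=\big(\bigcup_{t\in T}X_t,\oplus c_t\big)$ be their sum. Then $(X,c)$ is ČF$T_0$ if and only if each $(X_t,c_t)$ is ČF$T_0$.
   Context: $I=[0,1]$; a fuzzy (sub)set of a non-empty set $X$ is a map $f:X\to I$, and $I^X$ is the set of all of them, ordered pointwise, with $\vee,\wedge$ pointwise supremum/infimum. $\underline 0$ is the constant $0$ fuzzy set; $1_A$ is the characteristic function of $A\subseteq X$; the complement is $\mathfrak{Co}(f)(x)=1-f(x)$. For $x\in X$ and $0<\lambda\le1$, the fuzzy point $x_\lambda$ has value $\lambda$ at $x$ and $0$ elsewhere; $x_\lambda\in f$ means $x_\lambda\le f$, i.e. $\lambda\le f(x)$. Fuzzy points $x_\lambda,y_\gamma$ are distinct if $x\ne y$. A fuzzy closure space is a pair $(X,c)$ with $X$ a non-empty set and $c:I^X\to I^X$ satisfying $c(\underline 0)=\underline 0$, $f\le c(f)$, and $c(f\vee g)=c(f)\vee c(g)$ for all $f,g\in I^X$ (idempotency is not required). Sum: if the sets $X_t$ are pairwise disjoint, $X=\bigcup_{t\in T}X_t$ and $\oplus c_t(f)=\bigvee_{t\in T}c_t(1_{X_t}\wedge f)$ for $f\in I^X$, where $1_{X_t}\wedge f$ is regarded as a fuzzy subset of $X_t$ and $c_t(\cdot)\in I^{X_t}$ is extended by $0$ to $X$. $(X,c)$ is ČF$T_0$ if for every two distinct fuzzy points $x_\lambda,y_\gamma$ of $X$, either $x_\lambda\in\mathfrak{Co}(c(y_\gamma))$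 or $y_\gamma\in\mathfrak{Co}(c(x_\lambda))$. *)

(* Defs.v *)
From HB Require Import structures.
From mathcomp Require Import all_boot all_order all_algebra.
From mathcomp Require Import all_classical all_reals interval_inference.

Set Implicit Arguments.
Unset Strict Implicit.
Unset Printing Implicit Defensive.

Import Order.TTheory GRing.Theory Num.Theory.

Local Open Scope classical_set_scope.
Local Open Scope ring_scope.

Definition fuzzy (R : realType) (X : Type) : Type := X -> {i01 R}.

Lemma i01_ge0 (R : realType) (a : {i01 R}) : 0%:i01 <= a.
Proof. by have : 0 <= a%:num by []. Qed.

Lemma i01_le1 (R : realType) (a : {i01 R}) : a <= 1%:i01.
Proof. by have : a%:num <= 1 by []. Qed.

Section UnitIntervalSup.
Variables (R : realType) (J : Type).
Implicit Type u : J -> {i01 R}.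

Lemma i01_sup_ge0 u : 0 <= sup (range (fun j => (u j)%:num)).
Proof.
have [->|/set0P[_ [j _ _]]] := eqVneq (range (fun j => (u j)%:num)) set0.
  by rewrite sup0.
apply: (@le_trans _ _ (u j)%:num); first exact: ge0.
apply: ub_le_sup; last by exists j.
by exists 1 => _ [k _ <-]; exact: le1.
Qed.

Lemma i01_sup_le1 u : sup (range (fun j => (u j)%:num)) <= 1.
Proof.
have [->|/set0P ne] := eqVneq (range (fun j => (u j)%:num)) set0.
  by rewrite sup0 ler01.
by apply: ge_sup => // _ [k _ <-]; exact: le1.
Qed.

(* Supremum in [0,1]; it is 0 for the empty family because [sup set0 = 0]. *)
Definition i01_sup u : {i01 R} := Itv01 (i01_sup_ge0 u) (i01_sup_le1 u).

Lemma i01_sup_ub u j : u j <= i01_sup u.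
Proof.
have : (u j)%:num <= sup (range (fun j => (u j)%:num)).
  apply: ub_le_sup; last by exists j.
  by exists 1 => _ [k _ <-]; exact: le1.
by [].
Qed.

Lemma i01_sup_lub u a : (forall j, u j <= a) -> i01_sup u <= a.
Proof.
move=> ua; change (sup (range (fun j => (u j)%:num)) <= a%:num).
have [->|/set0P ne] := eqVneq (range (fun j => (u j)%:num)) set0.
  by rewrite sup0; exact: ge0.
by apply: ge_sup => // _ [k _ <-]; exact: ua.
Qed.

End UnitIntervalSup.

Section FuzzySets.
Variables (R : realType) (X : Type).
Implicit Types (f g : fuzzy R X) (A : set X) (x : X) (l : {i01 R}).

Definition fuzzy_le f g : Prop := forall x, f x <= g x.
Definition fuzzy_zero : fuzzy R X := fun=> 0%:i01.
Definition fuzzy_join f g : fuzzy R X := fun x => Num.max (f x) (g x).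
Definition fuzzy_meet f g : fuzzy R X := fun x => Num.min (f x) (g x).
Definition fuzzy_sup (J : Type) (F : J -> fuzzy R X) : fuzzy R X :=
  fun x => i01_sup (fun j => F j x).
Definition fuzzy_char A : fuzzy R X :=
  fun x => if x \in A then 1%:i01 else 0%:i01.
Definition fuzzy_compl f : fuzzy R X := fun x => (1 - (f x)%:num)%:i01.

(* This is a fuzzy point only for [0 < l], which has to be assumed
   wherever fuzzy points are quantified over. *)
Definition fuzzy_point x l : fuzzy R X :=
  fun y => if `[< y = x >] then l else 0%:i01.

Definition fuzzy_point_in x l f : Prop := fuzzy_le (fuzzy_point x l) f.

Record fuzzy_closure (c : fuzzy R X -> fuzzy R X) : Prop := FuzzyClosure {
  fuzzy_closure_inhabited : inhabited X;
  fuzzy_closure0 : c fuzzy_zero = fuzzy_zero;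
  fuzzy_closure_ge : forall f, fuzzy_le f (c f);
  fuzzy_closureU : forall f g, c (fuzzy_join f g) = fuzzy_join (c f) (c g)
}.

Definition CFT0 (c : fuzzy R X -> fuzzy R X) : Prop :=
  forall (x y : X) (l m : {i01 R}),
    0 < l%:num -> 0 < m%:num -> x <> y ->
    fuzzy_point_in x l (fuzzy_compl (c (fuzzy_point y m))) \/
    fuzzy_point_in y m (fuzzy_compl (c (fuzzy_point x l))).

End FuzzySets.

(* Subsets of [U] are used as types through the coercion [set_type]. *)
Section SubsetTransport.
Variables (R : realType) (U : Type) (A B : set U).

Definition subset_incl (AB : A `<=` B) (x : A) : B :=
  SigSub (mem_set (AB _ (set_mem (valP x)))).

Definition fuzzy_restrict (AB : A `<=` B) (f : fuzzy R B) : fuzzy R A :=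
  fun x => f (subset_incl AB x).

Lemma fuzzy_restrict0 (AB : A `<=` B) :
  fuzzy_restrict AB (@fuzzy_zero R B) = @fuzzy_zero R A.
Proof. by []. Qed.

Lemma fuzzy_restrictU (AB : A `<=` B) (f g : fuzzy R B) :
  fuzzy_restrict AB (fuzzy_join f g) =
  fuzzy_join (fuzzy_restrict AB f) (fuzzy_restrict AB g).
Proof. by []. Qed.

Definition fuzzy_extend (g : fuzzy R A) : fuzzy R B :=
  fun y => oapp g 0%:i01 (insub (val y)).

Lemma fuzzy_extendU (f g : fuzzy R A) :
  fuzzy_extend (fuzzy_join f g) =
  fuzzy_join (fuzzy_extend f) (fuzzy_extend g).
Proof.
apply/funext => y; rewrite /fuzzy_join /fuzzy_extend.
by case: insub => //=; rewrite maxxx.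
Qed.

End SubsetTransport.

Section FuzzySum.
Variables (R : realType) (U T : Type) (X : T -> set U).
Variable c : forall t : T, fuzzy R (X t) -> fuzzy R (X t).

Definition sum_carrier : set U := \bigcup_t X t.

Lemma sub_sum_carrier t : X t `<=` sum_carrier.
Proof. by move=> x Xx; exists t. Qed.

Definition sum_component t : set sum_carrier := [set x | X t (val x)].

Definition fuzzy_sum (f : fuzzy R sum_carrier) : fuzzy R sum_carrier :=
  fuzzy_sup (fun t : T => fuzzy_extend (B := sum_carrier)
    (c (fuzzy_restrict (@sub_sum_carrier t)
         (fuzzy_meet (fuzzy_char R (sum_component t)) f)))).

Lemma fuzzy_restrict_component t (f : fuzzy R sum_carrier) :
  fuzzy_restrict (@sub_sum_carrier t)
    (fuzzy_meet (fuzzy_char R (sum_component t)) f) =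
  fuzzy_restrict (@sub_sum_carrier t) f.
Proof.
apply/funext => x; rewrite /fuzzy_restrict /fuzzy_meet /fuzzy_char.
rewrite mem_set; last exact: set_mem (valP x).
by apply/min_idPr; exact: i01_le1.
Qed.

Lemma fuzzy_sumE (f : fuzzy R sum_carrier) :
  fuzzy_sum f = fuzzy_sup (fun t : T =>
    fuzzy_extend (c (fuzzy_restrict (@sub_sum_carrier t) f))).
Proof.
apply/funext => y; congr i01_sup; apply/funext => t.
by rewrite fuzzy_restrict_component.
Qed.

Lemma fuzzy_closure_sum : inhabited T -> (forall t, fuzzy_closure (@c t)) ->
  fuzzy_closure fuzzy_sum.
Proof.
move=> [t0] hc; split.
- have [[x] _ _ _] := hc t0.
  exact: inhabits (subset_incl (@sub_sum_carrier t0) x).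
- rewrite fuzzy_sumE; apply/funext => y.
  apply/le_anti/andP; split; last exact: i01_ge0.
  apply: i01_sup_lub => t; rewrite fuzzy_restrict0 (fuzzy_closure0 (hc t)).
  by rewrite /fuzzy_extend; case: insub.
- move=> f y; rewrite fuzzy_sumE; have [t _ Xty] := set_mem (valP y).
  apply: le_trans (i01_sup_ub _ t).
  rewrite /fuzzy_extend; case: insubP => [x _ xy|]; last by rewrite mem_set.
  apply: le_trans (fuzzy_closure_ge (hc t) _ _).
  rewrite /fuzzy_restrict; set z := subset_incl _ _.
  by have -> : z = y by exact: val_inj.
- move=> f g; rewrite !fuzzy_sumE; apply/funext => y.
  apply/le_anti/andP; split.
    apply: i01_sup_lub => t.
    rewrite fuzzy_restrictU (fuzzy_closureU (hc t)) fuzzy_extendU.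
    rewrite /fuzzy_join ge_max !le_max.
    by rewrite (i01_sup_ub (fun t => fuzzy_extend (c _) y) t)
      (i01_sup_ub (fun t => fuzzy_extend (c (_ _ g)) y) t) orbT.
  rewrite /fuzzy_join ge_max; apply/andP; split;
    apply: i01_sup_lub => t; apply: le_trans (i01_sup_ub _ t);
    rewrite fuzzy_restrictU (fuzzy_closureU (hc t)) fuzzy_extendU;
    by rewrite /fuzzy_join le_max lexx ?orbT.
Qed.

End FuzzySum.

(* Main.v *)
Require Import Defs.
From mathcomp Require Import all_boot all_order all_algebra.
From mathcomp Require Import all_classical all_reals interval_inference.

(** On a component [X t] the sum closure of [f] is the [c t]-closure of the
    restriction of [f], by disjointness. A fuzzy point supported in [X t]
    restricts to itself on [X t] and to [0] on the other components, so
    separation within a component is that of [c t], and points of different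
    components are always separated. *)

Import Order.TTheory GRing.Theory Num.Theory.
Local Open Scope classical_set_scope.
Local Open Scope ring_scope.

Section FuzzyPoints.
Context {R : realType}.

Lemma fuzzy_point_inE (X : Type) (x : X) (l : {i01 R}) (f : fuzzy R X) :
  fuzzy_point_in x l f <-> l <= f x.
Proof.
split=> [/(_ x)|lf y]; rewrite /fuzzy_point.
  by rewrite asboolT.
by case: asboolP => [->//|_]; exact: i01_ge0.
Qed.

(** The complement takes the value 1 at [x]. This settles points of different components, where the
    closure of one vanishes at the other. *)
Lemma fuzzy_compl_eq0 (X : Type) (x : X) (l : {i01 R}) (f : fuzzy R X) :
  f x = 0%:i01 -> l <= fuzzy_compl f x.
Proof.
move=> fx0; suff : l%:num <= (fuzzy_compl f x)%:num by [].
by rewrite /= fx0 /= subr0.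
Qed.

Context {U : Type} {A B : set U} (AB : A `<=` B).

Lemma subset_incl_inj : injective (subset_incl AB).
Proof. by move=> x y /(congr1 val) /= xy; exact: val_inj. Qed.

Lemma fuzzy_restrict_point (y : A) (m : {i01 R}) :
  fuzzy_restrict AB (fuzzy_point (subset_incl AB y) m) = fuzzy_point y m.
Proof.
apply/funext => x; rewrite /fuzzy_restrict /fuzzy_point.
congr (if _ then _ else _); apply: asbool_equiv_eq.
by split=> [/subset_incl_inj|->].
Qed.

Lemma fuzzy_restrict_point_out (y : B) (m : {i01 R}) : ~ A (val y) ->
  fuzzy_restrict AB (fuzzy_point y m) = @fuzzy_zero R A.
Proof.
move=> nAy; apply/funext => x; rewrite /fuzzy_restrict /fuzzy_point.
case: asboolP => // xy; case: nAy; rewrite -xy /=.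
exact: set_mem (valP x).
Qed.

End FuzzyPoints.

Section DisjointSum.
Context {R : realType} {U T : Type} {X : T -> set U}.
Variable c : forall t : T, fuzzy R (X t) -> fuzzy R (X t).
Hypothesis Xdisj : trivIset [set: T] X.

Let incl t : X t -> sum_carrier X := subset_incl (@sub_sum_carrier _ _ X t).

Lemma sum_carrier_incl (y : sum_carrier X) : exists t x, y = incl t x.
Proof.
have [t _ Xty] := set_mem (valP y).
by exists t, (SigSub (mem_set Xty)); exact: val_inj.
Qed.

(** At a point of [X t] only the index [t] contributes to the supremum: every other term is an
    extension by 0 evaluated outside its component. *)
Lemma fuzzy_sum_incl t (x : X t) (f : fuzzy R (sum_carrier X)) :
  fuzzy_sum c f (incl t x) =
  c t (fuzzy_restrict (@sub_sum_carrier _ _ X t) f) x.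
Proof.
rewrite fuzzy_sumE; apply/le_anti/andP; split.
- apply: i01_sup_lub => s; rewrite /fuzzy_extend.
  case: insubP => [z _ /= zx|_]; last exact: i01_ge0.
  have st : s = t.
    apply: (Xdisj _ _ I I); exists (sval x).
    by split; [rewrite -zx; exact: set_mem (valP z)|exact: set_mem (valP x)].
  (* Eliminating [st] puts [z] and [x] in the same type, where equal values in [U] make them
     equal. *)
  by case: t / st x zx => x /val_inj ->.
- apply: le_trans (i01_sup_ub _ t); rewrite /fuzzy_extend.
  by rewrite [insub _](_ : _ = Some x)//; exact: valK.
Qed.

End DisjointSum.

Theorem theorem4p4 (R : realType) (U T : Type) (X : T -> set U)
    (c : forall t : T, fuzzy R (X t) -> fuzzy R (X t))
    (Xdisj : trivIset [set: T]%classic X)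
    (hc : forall t : T, fuzzy_closure (c t)) :
  CFT0 (fuzzy_sum c) <-> (forall t : T, CFT0 (c t)).
Proof.
(* Both alternatives of the separation condition have this form, so [sumP] serves both directions of
   the equivalence. *)
have sumP t (x y : X t) (l m : {i01 R}) :
    let i := subset_incl (@sub_sum_carrier _ _ X t) in
    fuzzy_point_in (i x) l (fuzzy_compl (fuzzy_sum c (fuzzy_point (i y) m)))
    <-> fuzzy_point_in x l (fuzzy_compl (c t (fuzzy_point y m))).
  rewrite /= !fuzzy_point_inE /fuzzy_compl.
  by rewrite fuzzy_sum_incl// fuzzy_restrict_point.
split=> [T0 t x y l m l0 m0 xy|T0 x' y' l m l0 m0].
  have /(T0 _ _ _ _ l0 m0) : subset_incl (@sub_sum_carrier _ _ X t) x <>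
      subset_incl (@sub_sum_carrier _ _ X t) y by move/subset_incl_inj.
  by rewrite !sumP.
have [t [x ->]] := sum_carrier_incl x'.
(* Either [y'] lies in the component [X t] of [x], and [T0] at [t] applies, or it lies outside
   [X t]. *)
have [[y ->] xy|nXty _] := pselect (exists y,
    y' = subset_incl (@sub_sum_carrier _ _ X t) y).
  by rewrite !sumP; apply: T0 => // exy; apply: xy; rewrite exy.
(* The point at [y'] restricts to 0 on [X t] and [c t] preserves 0, so its sum closure vanishes at
   [x], whatever the heights [l] and [m]. *)
left; apply/fuzzy_point_inE/fuzzy_compl_eq0.
rewrite fuzzy_sum_incl// fuzzy_restrict_point_out ?(fuzzy_closure0 (hc t))//.
move=> Xty; apply: nXty.
by exists (SigSub (mem_set Xty)); exact: val_inj.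
Qed.
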